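(* Let $\mathcal G$ be any grid, $T=(T_{l,r})_{(l,r)\in\mathcal G}$ any collection of local tests, $K\ge 0$ any integer, and consider any distribution of $(y_1,\dots,y_n)$ with $K$ change-points $\tau_1<\dots<\tau_K$. Let $\mathcal K^*\subset\{1,\dots,K\}$ be any subset and let $(\bar\tau_k,\bar r_k)_{k\in\mathcal K^*}$ be any elements of $\mathcal G$ such that, for all $k\in\mathcal K^*$, $$4(\bar r_k-1)<r_k\quad\text{and}\quad |\bar\tau_k-\tau_k|\le \bar r_k-1 .$$ Let $\mathcal A$ be the event on which both of the following hold: (i) $T_{l,r}=0$ for all $(l,r)\in\mathcal H_0\cap\mathcal G$; (ii) $T_{\bar\tau_k,\bar r_k}=1$ for every $k\in\mathcal K^*$. Then, on the event $\mathcal A$, the vector $\hat\tau=(\hat\tau_1,\dots,\hat\tau_{\hat K})$ returned by the bottom-up aggregation procedure satisfies: 1. for all $k\in\mathcal K^*$ there exists $k'\le \hat K$ such that $|\hat\tau_{k'}-\tau_k|\le \bar r_k-1<\frac{r_k}{4}$; 2. $\hat\tau$ satisfies (NoSp).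
   Context: Setting. $Y=(y_1,\dots,y_n)$ is a random sequence, $\mathbb P_t$ is the marginal distribution of $y_t$, and $\Gamma$ is a map from probability distributions to some set $\mathcal V$. The change-points $1=\tau_0<\tau_1<\dots<\tau_K<\tau_{K+1}=n+1$ are the integers such that $\Gamma(\mathbb P_t)$ is constant for $t\in[\tau_k,\tau_{k+1}-1]$ ($0\le k\le K$) and $\Gamma(\mathbb P_{\tau_k-1})\ne\Gamma(\mathbb P_{\tau_k})$ ($1\le k\le K$). The length of $\tau_k$ is $r_k=\min(\tau_{k+1}-\tau_k,\tau_k-\tau_{k-1})$. Grid. A grid $\mathcal G$ is a subset of $J_n=\{(l,r): r=1,\dots,\lfloor n/2\rfloor,\ l=r+1,\dots,n-r+1\}$. Set $\mathcal R=\{r:\exists l,\ (l,r)\in\mathcal G\}$ and $\mathcal D_r=\{l:(l,r)\in\mathcal G\}$. A collection of local tests is a family of $\{0,1\}$-valued functions $T_{l,r}$ of the data, $(l,r)\in\mathcal G$. $\mathcal H_0$ is the set of $(l,r)\in J_n$ such that $(l-r,l+r)\cap\{\tau_1,\dots,\tau_K\}=\emptyset$. Bottom-up aggregation procedure. Process $r\in\mathcal R$ in increasing order and define (closed real intervals) $$\mathcal T_r=\Big\{l\in\mathcal D_r: T_{l,r}=1,\ [l-r+1,l+r-1]\cap\bigcup_{r'<r,\,r'\in\mathcal R}\mathcal S_{r'}=\emptyset\Big\},\qquad \mathcal S_r=\bigcup_{l\in\mathcal T_r}[l-r+1,l+r-1].$$ Let $C_1,\dots,C_{\hat K}$ be the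 connected components of $\bigcup_{r\in\mathcal R}\mathcal S_r$ in increasing order, and return $\hat\tau_k=\frac12(\min C_k+\max C_k)$, $k=1,\dots,\hat K$. (NoSp). $\hat\tau$ satisfies (NoSp) if for all $1\le k\le K$ the interval $[\tau_k-\frac{\tau_k-\tau_{k-1}}2,\tau_k+\frac{\tau_{k+1}-\tau_k}2]$ contains at most one element of $\{\hat\tau_{k'}\}_{k'\le\hat K}$, and $\{\hat\tau_{k'}\}_{k'\le\hat K}\subset[\tau_1-\frac{\tau_1-1}2,\tau_K+\frac{n+1-\tau_K}2]$. For $K=0$, (NoSp) means $\hat K=0$. *)

(* Defs.v *)
From mathcomp Require Import all_boot all_order all_algebra.
From mathcomp Require Import finmap.
From mathcomp Require Import all_classical all_reals all_analysis.
Import Order.TTheory GRing.Theory Num.Theory.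
Import numFieldNormedType.Exports.

Set Implicit Arguments.
Unset Strict Implicit.
Unset Printing Implicit Defensive.

Local Open Scope classical_set_scope.
Local Open Scope ring_scope.

(* Time [t] in {1, ..., n} is the ordinal [i : 'I_n] with [t = i.+1]; [theta i]
   is the parameter at that time. Only [tau 0], ..., [tau K.+1] matter. *)
Definition is_change_points (n K : nat) (V : Type) (theta : 'I_n -> V)
    (tau : nat -> nat) : Prop :=
  [/\ tau 0%N = 1%N,
      tau K.+1 = n.+1,
      forall k : nat, (k <= K)%N -> (tau k < tau k.+1)%N,
      forall (k : nat) (i j : 'I_n), (k <= K)%N ->
        (tau k <= i.+1 <= tau k.+1 - 1)%N ->
        (tau k <= j.+1 <= tau k.+1 - 1)%N -> theta i = theta j
    & forall (k : nat) (i j : 'I_n), (1 <= k <= K)%N ->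
        i.+1 = (tau k - 1)%N -> j.+1 = tau k -> theta i <> theta j].

Definition cp_length (tau : nat -> nat) (k : nat) : nat :=
  minn (tau k.+1 - tau k) (tau k - tau k.-1).

Definition full_grid (n : nat) : set (nat * nat) :=
  [set lr | (1 <= lr.2 <= n %/ 2)%N /\ (lr.2 + 1 <= lr.1 <= n - lr.2 + 1)%N].

Definition grid_scales (G : set (nat * nat)) : set nat :=
  [set r | exists l, G (l, r)].

Definition grid_positions (G : set (nat * nat)) (r : nat) : set nat :=
  [set l | G (l, r)].

Definition null_pairs (R : realType) (n K : nat) (tau : nat -> nat) :
    set (nat * nat) :=
  [set lr | full_grid n lr /\
     `](lr.1%:R - lr.2%:R), (lr.1%:R + lr.2%:R)[%classic `&`
       [set ((tau k)%:R : R) | k in [set k | (1 <= k <= K)%N]] = set0].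

Definition window (R : realType) (l r : nat) : set R :=
  `[(l%:R - r%:R + 1), (l%:R + r%:R - 1)]%classic.
Arguments window : clear implicits.

(* Positions kept at scale [r] when [A] is the region already covered;
   [t l r] is the outcome of the test at [(l, r)]. *)
Definition retained (R : realType) (G : set (nat * nat))
    (t : nat -> nat -> bool) (A : set R) (r : nat) : set nat :=
  [set l | [/\ grid_positions G r l, t l r & window R l r `&` A = set0]].

(* Region covered by the scales smaller than [r]. The recursion visits every
   integer scale; those outside [grid_scales G] contribute nothing, see
   [coveredE]. *)
Fixpoint covered (R : realType) (G : set (nat * nat))
    (t : nat -> nat -> bool) (r : nat) : set R :=
  if r is s.+1 then
    @covered R G t s `|`
      \bigcup_(l in retained G t (@covered R G t s) s) window R l s
  else set0.
Arguments covered : clear implicits.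

Definition detections (R : realType) (G : set (nat * nat))
    (t : nat -> nat -> bool) (r : nat) : set nat :=
  retained G t (covered R G t r) r.

Definition detected_region (R : realType) (G : set (nat * nat))
    (t : nat -> nat -> bool) (r : nat) : set R :=
  \bigcup_(l in detections R G t r) window R l r.
Arguments detected_region : clear implicits.

Lemma coveredE (R : realType) (G : set (nat * nat)) (t : nat -> nat -> bool)
    (r : nat) :
  covered R G t r =
  \bigcup_(s in [set s | grid_scales G s /\ (s < r)%N]) detected_region R G t s.
Proof.
elim: r => [|r IHr].
  by apply/seteqP; split=> x //= [s []].
rewrite [LHS]/= -/(detections R G t r) -/(detected_region R G t r).
apply/seteqP; split=> x.
  case=> [|[l [Gl tl wl] lx]].
    by rewrite IHr => -[s [Gs sr] sx]; exists s => //; split=> //; exact: leqW.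
  by exists r; [split; [exists l|exact: ltnSn]|exists l].
move=> [s [Gs]]; rewrite ltnS leq_eqVlt => /orP[/eqP -> rx|sr sx].
  by right.
by left; rewrite IHr; exists s.
Qed.

Definition components (R : realType) (A : set R) : set (set R) :=
  [set C | exists2 x, A x & C = connected_component A x].

(* For [A] a finite union of nonempty compact intervals, [components A] is
   finite and each component [C] is a compact interval, so that [inf C] and
   [sup C] are its minimum and its maximum. *)
Definition midpoints (R : realType) (A : set R) : seq R :=
  [seq (inf C + sup C) / 2 |
    C : set R <- sort (fun C D : set R => inf C <= inf D)
                      (fset_set (components A))].

Definition bottom_up (R : realType) (G : set (nat * nat))
    (t : nat -> nat -> bool) : seq R :=
  midpoints (\bigcup_(r in grid_scales G) detected_region R G t r).

Definition NoSp (R : realType) (n K : nat) (tau : nat -> nat) (that : seq R) :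
    Prop :=
  if K == 0%N then size that = 0%N
  else
    (forall k : nat, (1 <= k <= K)%N ->
       is_subset1 ([set` that] `&`
         `[((tau k)%:R - ((tau k)%:R - (tau k.-1)%:R) / 2),
           ((tau k)%:R + ((tau k.+1)%:R - (tau k)%:R) / 2)]%classic)) /\
    [set` that] `<=`
      `[((tau 1)%:R - ((tau 1)%:R - 1) / 2),
        ((tau K)%:R + (n%:R + 1 - (tau K)%:R) / 2)]%classic.

(* Main.v *)
Require Import Defs.
From mathcomp Require Import all_boot all_order all_algebra.
From mathcomp Require Import lra zify.
From mathcomp Require Import all_classical all_reals all_analysis.
Import Order.TTheory GRing.Theory Num.Theory.
Import numFieldNormedType.Exports.

Set Implicit Arguments.
Unset Strict Implicit.
Unset Printing Implicit Defensive.

Local Open Scope classical_set_scope.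
Local Open Scope ring_scope.

(** Call a window kept when its test equals 1 and the procedure retains it. On
    the event considered, a test equal to 1 sits at a pair that is not null, so
    every kept window contains a change-point ([non_null_pair_cp]). The rest is
    deterministic geometry of intervals. The detected region is a finite union
    of kept windows, so its components are finitely many compact intervals and
    their midpoints are the returned positions.

    Detection ([bottom_up_detects]). A window tested positive near tau_k is
    either kept or blocked by a kept window of smaller scale; either way a kept
    window of scale r at most rbar_k meets it. The change-point in that window
    is within 4 (rbar_k - 1) < r_k of tau_k, hence is tau_k. Windows of distinct
    scales are disjoint, and a window of scale r meeting one that contains tau_k
    contains a change-point within 4 (r - 1) of tau_k, that is tau_k itself. So
    the component of tau_k is the union of the scale-r kept windows containing
    tau_k ([kept_component_sub]), and its midpoint, an average of two centers of
    such windows, is within r - 1 of tau_k.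

    No spurious detection ([bottom_up_NoSp]). Call cell of tau_k the interval
    from (tau_(k-1) + tau_k) / 2 to (tau_k + tau_(k+1)) / 2. A component
    contains some change-point tau_j. If it misses tau_k, it lies on one side of
    tau_k and reaches tau_(k-1) or tau_(k+1), which pushes its midpoint out of
    the cell of tau_k ([cell_midpoint_mem]). So a midpoint in the cell of tau_k
    comes from the component of tau_k, and there is only one. The outer bounds
    hold because a component lies between 1 and n + 1 and reaches both a point
    at least tau_1 and a point at most tau_K, namely tau_j. *)

(** * Components and midpoints of a compact subset of the line *)

(** The ends of a component are attained. Hence a component that misses a
    change-point has its ends strictly on one side of it, and this strictness
    keeps the midpoint off the boundary of a closed cell. *)
Lemma compact_component_itv (R : realType) (A C : set R) :
  closed A -> has_lbound A -> has_ubound A -> components A C ->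
  C = `[inf C, sup C]%classic.
Proof.
move=> Acl [lo loA] [hi hiA] [x Ax Cx].
have CA : C `<=` A by rewrite Cx; exact: connected_component_sub.
have Ccl : closed C by rewrite Cx; exact: component_closed.
have C0 : C !=set0 by exists x; rewrite Cx; exact: connected_component_refl.
have lC : has_lbound C by exists lo => y /CA /loA.
have uC : has_ubound C by exists hi => y /CA /hiA.
have Citv : is_interval C.
  by apply/connected_intervalP; rewrite Cx; exact: component_connected.
have Cinf : C (inf C).
  apply: (itv_closed_infimums C0 Ccl); split; first exact: ge_inf.
  by move=> y; exact: lb_le_inf.
have Csup : C (sup C).
  apply: (itv_closed_supremums C0 Ccl); split; first exact: ub_le_sup.
  by move=> y; exact: ge_sup.
apply/seteqP; split=> y /=; rewrite in_itv /=.
  by move=> Cy; rewrite ge_inf //= ub_le_sup.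
exact: Citv.
Qed.

Lemma components_same (R : realType) (A C D : set R) (x : R) :
  components A C -> components A D -> C x -> D x -> C = D.
Proof.
by move=> [c _ ->] [d _ ->] /same_connected_component -> /same_connected_component ->.
Qed.

Lemma mem_midpoints (R : realType) (A : set R) (x : R) :
  finite_set (components A) ->
  x \in midpoints A <-> exists2 C, components A C & x = (inf C + sup C) / 2.
Proof.
move=> finA; split.
  by move=> /mapP[C]; rewrite mem_sort in_fset_set // inE => ? ->; exists C.
move=> [C AC ->]; apply/mapP; exists C => //.
by rewrite mem_sort in_fset_set // inE.
Qed.

(** * Unions of windows *)

(** Seen as a closed ball around its center, a window yields distance bounds
    between change-points by the triangle inequality. *)
Lemma windowP (R : realType) (l r : nat) (x : R) :
  window R l r x <-> `|x - l%:R| <= r%:R - 1.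
Proof. by rewrite /window /= in_itv /= ler_distl opprB !addrA [_ + 1 - _]addrAC. Qed.

Lemma closed_window (R : realType) (l r : nat) : closed (window R l r).
Proof. exact: itv_closed. Qed.

Lemma window_center (R : realType) (l r : nat) :
  (0 < r)%N -> window R l r l%:R.
Proof. by move=> r0; apply/windowP; rewrite subrr normr0 subr_ge0 ler1n. Qed.

(** The windows are indexed by arbitrary sets of pairs because the detected
    region is later split into two such unions. *)
Definition windows (R : realType) (D : set (nat * nat)) : set R :=
  \bigcup_(lr in D) window R lr.1 lr.2.
Arguments windows : clear implicits.

Lemma closed_windows (R : realType) (D : set (nat * nat)) :
  finite_set D -> closed (windows R D).
Proof. by move=> finD; apply: closed_bigcup => // lr _; exact: closed_window. Qed.

(** A window is connected, so the component of any of its points is the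
    component of its center, and there are at most as many components as
    windows. *)
Lemma finite_components_windows (R : realType) (D : set (nat * nat)) :
  finite_set D -> finite_set (components (windows R D)).
Proof.
move=> finD.
apply: (@sub_finite_set _ _
  ((fun lr : nat * nat => connected_component (windows R D) lr.1%:R) @` D));
  last exact: finite_image.
move=> C [x [[l r] Dlr wx] ->]; exists (l, r) => //=.
apply: same_connected_component.
(* A window of scale 0 is empty. *)
have r0 : (0 < r)%N.
  by move/windowP: wx => /(le_trans (normr_ge0 _)); rewrite subr_ge0 ler1n.
have wl := window_center R l r0.
apply: (connected_component_max (B := window R l r)) => //.
  by move=> y wy; exists (l, r).
exact: segment_connected.
Qed.

Lemma finite_sub_full_grid (n : nat) (D : set (nat * nat)) :
  D `<=` full_grid n -> finite_set D.
Proof.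
move=> Dn; apply: (@sub_finite_set _ _ (`I_n.+2 `*` `I_n.+2)).
  by move=> [l r] /Dn [] /=; rewrite /full_grid /=; lia.
by apply: finite_setX; exact: finite_II.
Qed.

Lemma windows_bounds (R : realType) (n : nat) (D : set (nat * nat)) (x : R) :
  D `<=` full_grid n -> windows R D x -> 2 <= x <= n%:R.
Proof.
move=> Dn [[l r] /Dn [/= hr hl]]; rewrite /window /= in_itv /=.
have h1 : (r + 1)%:R <= l%:R :> R by rewrite ler_nat; lia.
have h2 : (l + r)%:R <= n.+1%:R :> R by rewrite ler_nat; lia.
move: h1 h2; rewrite !natrD -natr1 => h1 h2 /andP[a b]; apply/andP; split; lra.
Qed.

(** * Windows kept by the aggregation procedure *)

Definition kept (R : realType) (G : set (nat * nat)) (t : nat -> nat -> bool) :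
  set (nat * nat) := [set lr | detections R G t lr.2 lr.1].
Arguments kept : clear implicits.

Lemma kept_test (R : realType) (G : set (nat * nat)) (t : nat -> nat -> bool) l r :
  kept R G t (l, r) -> G (l, r) /\ t l r.
Proof. by case. Qed.

Lemma bottom_upE (R : realType) (G : set (nat * nat)) (t : nat -> nat -> bool) :
  bottom_up R G t = midpoints (windows R (kept R G t)).
Proof.
congr midpoints; apply/seteqP; split=> x.
  by move=> [r _ [l dl wl]]; exists (l, r).
by move=> [[l r] dl wl]; exists r; [exists l; case: dl | exists l].
Qed.

(** A window is retained only if it avoids the region covered by all smaller
    scales. *)
Lemma kept_meet_scale_le (R : realType) (G : set (nat * nat))
    (t : nat -> nat -> bool) l r l' r' (x : R) :
  kept R G t (l, r) -> kept R G t (l', r') ->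
  window R l r x -> window R l' r' x -> (r <= r')%N.
Proof.
move=> [_ _ /= /seteqP[wcov _]] kl' wx wx'; rewrite leqNgt; apply/negP => ltr.
apply: (wcov x); split=> //; rewrite coveredE; exists r'; last by exists l'.
by split=> //; exists l'; case: kl'.
Qed.

Lemma kept_scale (R : realType) (G : set (nat * nat))
    (t : nat -> nat -> bool) l r l' r' (x : R) :
  kept R G t (l, r) -> kept R G t (l', r') ->
  window R l r x -> window R l' r' x -> r = r'.
Proof.
move=> kl kl' wx wx'; apply/eqP; rewrite eqn_leq.
by rewrite (kept_meet_scale_le kl kl' wx wx') (kept_meet_scale_le kl' kl wx' wx).
Qed.

(** A positive test which is not retained has been blocked by a kept window of
    smaller scale. *)
Lemma kept_near_detection (R : realType) (G : set (nat * nat)) (t : nat -> nat -> bool) l r :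
  (0 < r)%N -> G (l, r) -> t l r ->
  exists l' r' (x : R), [/\ kept R G t (l', r'), (r' <= r)%N,
    window R l r x & window R l' r' x].
Proof.
move=> r0 Glr tlr.
have [cov0|/eqP/set0P[x [wx]]] := pselect (window R l r `&` covered R G t r = set0).
  by exists l, r, l%:R; split; rewrite //; exact: window_center.
rewrite coveredE => -[s [_ sr] [l' kl' wx']].
by exists l', s, x; split; rewrite // ltnW.
Qed.

(** * Separation of the change-points *)

Lemma cp_le (K : nat) (tau : nat -> nat) (j k : nat) :
  (forall i, (i <= K)%N -> (tau i < tau i.+1)%N) ->
  (j <= k <= K.+1)%N -> (tau j <= tau k)%N.
Proof.
move=> tauS; elim: k => [|k IHk]; first by rewrite leqn0 => /andP[/eqP ->].
rewrite leq_eqVlt => /andP[/orP[/eqP -> //|jk] kK].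
by apply: leq_trans (ltnW (tauS k _)) => //; apply: IHk; rewrite -ltnS jk ltnW.
Qed.

(** The length of tau_k bounds from below its distance to both neighbours. *)
Lemma cp_close_eq (R : realType) (K : nat) (tau : nat -> nat) (j k : nat) :
  (forall i, (i <= K)%N -> (tau i < tau i.+1)%N) ->
  (1 <= j <= K)%N -> (1 <= k <= K)%N ->
  `|(tau j)%:R - (tau k)%:R| < (cp_length tau k)%:R :> R -> j = k.
Proof.
move=> tauS jK kK; rewrite ltr_distl => /andP[lo hi].
move: lo hi; rewrite ltrBlDr -!natrD !ltr_nat /cp_length => lo hi.
have [jk|kj|//] := ltngtP j k.
- have := @cp_le K tau j k.-1 tauS; have := @cp_le K tau k.-1 k tauS; lia.
- have := @cp_le K tau k.+1 j tauS; have := @cp_le K tau k k.+1 tauS; lia.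
Qed.

(** Change-points and window ends are integers, so a change-point in the open
    interval (l - r, l + r) lies in the closed interval [l - r + 1, l + r - 1]. *)
Lemma non_null_pair_cp (R : realType) (n K : nat) (tau : nat -> nat) (l r : nat) :
  full_grid n (l, r) -> ~ null_pairs R n K tau (l, r) ->
  exists2 k, (1 <= k <= K)%N & window R l r (tau k)%:R.
Proof.
move=> nlr Hlr.
have /eqP/set0P[x [xlr [k kK xE]]] :
    `](l%:R - r%:R), (l%:R + r%:R)[%classic `&`
    [set ((tau k)%:R : R) | k in [set k | (1 <= k <= K)%N]] <> set0.
  by move=> H; apply: Hlr.
exists k => //; move: xlr; rewrite -xE /window /= !in_itv /= ltrBlDr -!natrD !ltr_nat.
rewrite addrAC lerBlDr lerBrDr natr1 -natrD natr1 !ler_nat.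
by move=> /andP[-> ->].
Qed.

(** * Components of the detected region *)

(** An interval that contains tau_j and lies strictly to the right of tau_k
    reaches tau_(k+1), so its midpoint exceeds (tau_k + tau_(k+1)) / 2; the other
    side is symmetric. The inequality is strict because the ends belong to the
    interval, hence differ from tau_k. *)
Lemma cell_midpoint_mem (R : realType) (K : nat) (tau : nat -> nat) (j k : nat)
    (a b : R) :
  (forall i, (i <= K)%N -> (tau i < tau i.+1)%N) ->
  (1 <= j <= K)%N -> (1 <= k <= K)%N ->
  `[a, b]%classic (tau j)%:R ->
  `[((tau k)%:R - ((tau k)%:R - (tau k.-1)%:R) / 2),
    ((tau k)%:R + ((tau k.+1)%:R - (tau k)%:R) / 2)]%classic ((a + b) / 2) ->
  `[a, b]%classic (tau k)%:R.
Proof.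
move=> tauS jK kK; rewrite /= !in_itv /= => /andP[aj jb] /andP[lo hi].
have [jk|kj|<-] := ltngtP j k; last by rewrite aj.
- have : (tau j)%:R <= (tau k.-1)%:R :> R by rewrite ler_nat; apply: (cp_le tauS); lia.
  have : (tau k.-1)%:R < (tau k)%:R :> R.
    by rewrite ltr_nat; have := tauS k.-1; rewrite prednK; [apply|]; lia.
  by move=> *; apply/andP; split; lra.
- have : (tau k.+1)%:R <= (tau j)%:R :> R by rewrite ler_nat; apply: (cp_le tauS); lia.
  have : (tau k)%:R < (tau k.+1)%:R :> R by rewrite ltr_nat; apply: tauS; lia.
  by move=> *; apply/andP; split; lra.
Qed.

(** The kept windows of scale [r] that contain tau_k form a closed set disjoint
    from the other kept windows, which form a closed set too: the component of
    tau_k cannot leave the former. *)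
Lemma kept_component_sub (R : realType) (G : set (nat * nat))
    (t : nat -> nat -> bool) (K : nat) (tau : nat -> nat) (k l r : nat) :
  finite_set (kept R G t) ->
  (forall i, (i <= K)%N -> (tau i < tau i.+1)%N) ->
  (forall l' r', kept R G t (l', r') ->
    exists2 j, (1 <= j <= K)%N & window R l' r' (tau j)%:R) ->
  (1 <= k <= K)%N -> 4 * (r%:R - 1) < (cp_length tau k)%:R :> R ->
  kept R G t (l, r) -> window R l r (tau k)%:R ->
  connected_component (windows R (kept R G t)) (tau k)%:R `<=`
  windows R (kept R G t `&` [set lr | lr.2 = r /\ window R lr.1 r (tau k)%:R]).
Proof.
move=> finD tauS cpD kK hr klr wk.
set D := kept R G t; set B := [set lr | _ /\ _].
have clB : closed (windows R (D `&` B)).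
  by apply: closed_windows; exact: sub_finite_set (@subIsetl _ _ _) finD.
have clB' : closed (windows R (D `\` B)).
  by apply: closed_windows; exact: sub_finite_set (@subDsetl _ _ _) finD.
have disj x : windows R (D `&` B) x -> windows R (D `\` B) x -> False.
  move=> [[l1 r1] [k1 /= [e1 w1]] w1x] [[l2 r2] [k2 nB] w2x].
  have e2 := kept_scale k1 k2 w1x w2x; apply: nB.
  rewrite /= in e1 w1 w1x w2x; subst r1; subst r2; split=> //=.
  have [j jK w2j] := cpD _ _ k2.
  (* A common point of the two windows is within 2 (r - 1) of tau_k and of
     tau_j, so tau_j is too close to tau_k to differ from it. *)
  rewrite -(cp_close_eq tauS jK kK (R := R)) //.
  apply: le_lt_trans hr.
  move: w1 w1x w2x w2j => /windowP + /windowP + /windowP + /windowP.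
  rewrite !ler_distl => /andP[? ?] /andP[? ?] /andP[? ?] /andP[? ?].
  by apply/andP; split; lra.
have sep : separated (windows R (D `&` B)) (windows R (D `\` B)).
  have /closure_id clE := clB; have /closure_id clE' := clB'.
  by split; rewrite -?clE -?clE'; apply/seteqP; split=> x // [] /disj.
have cover : connected_component (windows R D) (tau k)%:R `<=`
    windows R (D `&` B) `|` windows R (D `\` B).
  move=> x /connected_component_sub [lr Dlr wx].
  by have [Blr|nBlr] := pselect (B lr); [left|right]; exists lr.
have wB : windows R (D `&` B) (tau k)%:R by exists (l, r).
case: (connected_subset sep cover) => //; first exact: component_connected.
move=> sub; case: (disj _ wB); apply: sub; apply: connected_component_refl.
by exists (l, r).
Qed.

(** With s = r - 1, the component [a, b] of tau_k lies within 2 s of tau_k and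
    contains [l - s, l + s], where l is within s of tau_k. Hence
    a + b <= (l - s) + (tau_k + 2 s) <= 2 tau_k + 2 s, and symmetrically. *)
Lemma kept_component_midpoint (R : realType) (n : nat) (G : set (nat * nat))
    (t : nat -> nat -> bool) (K : nat) (tau : nat -> nat) (k l r : nat) :
  G `<=` full_grid n ->
  (forall i, (i <= K)%N -> (tau i < tau i.+1)%N) ->
  (forall l' r', kept R G t (l', r') ->
    exists2 j, (1 <= j <= K)%N & window R l' r' (tau j)%:R) ->
  (1 <= k <= K)%N -> 4 * (r%:R - 1) < (cp_length tau k)%:R :> R ->
  kept R G t (l, r) -> window R l r (tau k)%:R ->
  exists2 x, x \in bottom_up R G t & `|x - (tau k)%:R| <= r%:R - 1.
Proof.
move=> Gn tauS cpD kK hr klr wk.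
have Dn : kept R G t `<=` full_grid n by move=> [l' r'] /kept_test[/Gn].
have finD := finite_sub_full_grid Dn.
set U := windows R (kept R G t).
set C := connected_component U (tau k)%:R.
have AC : components U C by exists (tau k)%:R => //; exists (l, r).
exists ((inf C + sup C) / 2).
  by rewrite bottom_upE; apply/(mem_midpoints _ (finite_components_windows R finD)); exists C.
have CE : C = `[inf C, sup C]%classic.
  by apply: compact_component_itv AC; [exact: closed_windows|
    exists 2 => x /(windows_bounds Dn)/andP[]|
    exists n%:R => x /(windows_bounds Dn)/andP[]].
have wC : window R l r `<=` C.
  apply: connected_component_max => //; last exact: segment_connected.
  by move=> x wx; exists (l, r).
have Csub x : C x -> `|x - (tau k)%:R| <= 2 * (r%:R - 1).
  move=> /(kept_component_sub finD tauS cpD kK hr klr wk)[[l' r'] [_ /= [-> ]]].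
  move=> /windowP + /windowP; rewrite !ler_distl => /andP[? ?] /andP[? ?].
  by apply/andP; split; lra.
have CP x : C x <-> inf C <= x <= sup C by rewrite {1}CE /= in_itv.
have /CP/andP[infk ksup] : C (tau k)%:R by exact: wC.
have Cinf : C (inf C) by apply/CP; rewrite lexx (le_trans infk).
have Csup : C (sup C) by apply/CP; rewrite lexx (le_trans infk).
have r1 : 0 <= r%:R - 1 :> R.
  by move/windowP: wk; exact: le_trans.
have /CP/andP[linf _] : C (l%:R - (r%:R - 1)).
  by apply/wC/windowP; rewrite ler_distl; apply/andP; split; lra.
have /CP/andP[_ lsup] : C (l%:R + (r%:R - 1)).
  by apply/wC/windowP; rewrite ler_distl; apply/andP; split; lra.
move: wk (Csub _ Cinf) (Csub _ Csup) => /windowP; rewrite !ler_distl.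
move=> /andP[? ?] /andP[? ?] /andP[? ?].
by apply/andP; split; lra.
Qed.

(** * Guarantees on the returned positions *)

Lemma bottom_up_detects (R : realType) (n : nat) (G : set (nat * nat))
    (t : nat -> nat -> bool) (K : nat) (tau : nat -> nat) (k lbar rbar : nat) :
  G `<=` full_grid n ->
  (forall i, (i <= K)%N -> (tau i < tau i.+1)%N) ->
  (forall l r, kept R G t (l, r) ->
    exists2 j, (1 <= j <= K)%N & window R l r (tau j)%:R) ->
  (1 <= k <= K)%N -> G (lbar, rbar) -> t lbar rbar ->
  4 * (rbar%:R - 1) < (cp_length tau k)%:R :> R ->
  `|lbar%:R - (tau k)%:R| <= rbar%:R - 1 :> R ->
  exists2 x, x \in bottom_up R G t & `|x - (tau k)%:R| <= rbar%:R - 1.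
Proof.
move=> Gn tauS cpD kK Gbar tbar hr hl.
have rbar0 : (0 < rbar)%N by case: (Gn _ Gbar) => /= /andP[].
have [l [r [x [klr rr]]]] := kept_near_detection R rbar0 Gbar tbar.
move=> /windowP xbar wx.
have [j jK wj] := cpD _ _ klr.
have rrR : r%:R <= rbar%:R :> R by rewrite ler_nat.
have jk : j = k.
  (* tau_k and the common point x are each within rbar - 1 of lbar, and tau_j is
     within 2 (rbar - 1) of x. *)
  apply: (cp_close_eq tauS jK kK (R := R)); apply: le_lt_trans hr.
  move: hl xbar wx wj => + + /windowP + /windowP; rewrite !ler_distl.
  move=> /andP[? ?] /andP[? ?] /andP[? ?] /andP[? ?].
  by apply/andP; split; lra.
rewrite jk in wj.
have hr' : 4 * (r%:R - 1) < (cp_length tau k)%:R :> R by lra.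
have [y yin ynear] := kept_component_midpoint Gn tauS cpD kK hr' klr wj.
by exists y => //; lra.
Qed.

Lemma bottom_up_NoSp (R : realType) (n : nat) (G : set (nat * nat))
    (t : nat -> nat -> bool) (K : nat) (tau : nat -> nat) :
  tau 0%N = 1%N -> tau K.+1 = n.+1 ->
  G `<=` full_grid n ->
  (forall i, (i <= K)%N -> (tau i < tau i.+1)%N) ->
  (forall l r, kept R G t (l, r) ->
    exists2 j, (1 <= j <= K)%N & window R l r (tau j)%:R) ->
  NoSp n K tau (bottom_up R G t).
Proof.
move=> tau0 tauK Gn tauS cpD.
have Dn : kept R G t `<=` full_grid n by move=> [l r] /kept_test[/Gn].
have finD := finite_sub_full_grid Dn.
have bnd := @windows_bounds R n _ _ Dn.
rewrite bottom_upE.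
set U := windows R (kept R G t).
have midP x := mem_midpoints x (finite_components_windows R finD).
have comp C : components U C -> [/\ C = `[inf C, sup C]%classic,
    2 <= inf C, sup C <= n%:R & exists2 j, (1 <= j <= K)%N & C (tau j)%:R].
  move=> AC.
  have CE : C = `[inf C, sup C]%classic.
    by apply: compact_component_itv AC; [exact: closed_windows|
      exists 2 => x /bnd/andP[]|exists n%:R => x /bnd/andP[]].
  have CU : C `<=` U by case: AC => x _ ->; exact: connected_component_sub.
  have [j jK Cj] : exists2 j, (1 <= j <= K)%N & C (tau j)%:R.
    case: AC => x [[l r] klr wx] ->; have [j jK wj] := cpD _ _ klr.
    exists j => //; suff : window R l r `<=` connected_component U x by apply.
    apply: connected_component_max => //; last exact: segment_connected.
    by move=> y wy; exists (l, r).
  have C0 : C !=set0 by exists (tau j)%:R.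
  split=> //; [apply: lb_le_inf|apply: ge_sup|by exists j] => // x /CU/bnd/andP[] //.
rewrite /NoSp; case: eqP => [K0|K0].
  apply/eqP; rewrite size_eq0; case E : (midpoints U) => [//|x s].
  have /midP[C /comp[_ _ _ [j + _]] _] : x \in midpoints U by rewrite E mem_head.
  by rewrite K0; lia.
split=> [k kK x y [] /= /midP[C AC xE] kx [/midP[D AD yE] ky]|x /= /midP[C AC xE]].
  have Ck (B : set R) : components U B ->
      `[((tau k)%:R - ((tau k)%:R - (tau k.-1)%:R) / 2),
        ((tau k)%:R + ((tau k.+1)%:R - (tau k)%:R) / 2)]%classic
        ((inf B + sup B) / 2) -> B (tau k)%:R.
    move=> /comp[BE _ _ [j jK Bj]] hB; rewrite BE.
    by apply: cell_midpoint_mem tauS jK kK _ hB; rewrite -BE.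
  suff -> : x = (inf D + sup D) / 2 by rewrite yE.
  rewrite xE; rewrite xE in kx; rewrite yE in ky.
  by rewrite (components_same AC AD (Ck _ AC kx) (Ck _ AD ky)).
have [CE lo hi [j jK]] := comp _ AC.
rewrite CE /= !in_itv /= => /andP[loj jhi].
have : (tau 1%N)%:R <= (tau j)%:R :> R by rewrite ler_nat; apply: (cp_le tauS); lia.
have : (tau j)%:R <= (tau K)%:R :> R by rewrite ler_nat; apply: (cp_le tauS); lia.
by move=> *; apply/andP; split; lra.
Qed.

Theorem theorem1 (R : realType) (d d' : measure_display)
    (Omega : measurableType d) (E : measurableType d')
    (P : probability Omega R)
    (n : nat) (Y : 'I_n -> {RV P >-> E})
    (V : Type) (Gam : probability E R -> V)
    (K : nat) (tau : nat -> nat)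
    (htau : is_change_points K (fun i => Gam (distribution P (Y i))) tau)
    (G : set (nat * nat)) (hG : G `<=` full_grid n)
    (T : nat -> nat -> ('I_n -> E) -> bool)
    (Kstar : set nat) (hKstar : Kstar `<=` [set k | (1 <= k <= K)%N])
    (taubar rbar : nat -> nat)
    (hbarG : forall k, Kstar k -> G (taubar k, rbar k))
    (hrbar : forall k, Kstar k ->
       4 * ((rbar k)%:R - 1) < (cp_length tau k)%:R :> R)
    (htaubar : forall k, Kstar k ->
       `|(taubar k)%:R - (tau k)%:R| <= (rbar k)%:R - 1 :> R) :
  let data (w : Omega) : 'I_n -> E := fun i => Y i w in
  let A : set Omega :=
    [set w | (forall l r, (null_pairs R n K tau `&` G) (l, r) ->
                T l r (data w) = false) /\
             (forall k, Kstar k -> T (taubar k) (rbar k) (data w) = true)] in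
  forall w, A w ->
    let that : seq R := bottom_up R G (fun l r => T l r (data w)) in
    (forall k, Kstar k -> exists k' : nat,
       [/\ (k' < size that)%N,
           `|that`_k' - (tau k)%:R| <= (rbar k)%:R - 1
         & (rbar k)%:R - 1 < (cp_length tau k)%:R / 4 :> R]) /\
    NoSp n K tau that.
Proof.
move=> data A w [nullT starT] that.
have [tau0 tauK tauS _ _] := htau.
set t := fun l r => T l r (data w) in that *.
have cpD l r : kept R G t (l, r) ->
    exists2 j, (1 <= j <= K)%N & window R l r (tau j)%:R.
  move=> /kept_test[Glr tlr]; apply: non_null_pair_cp (hG _ Glr) _ => Hlr.
  by move: tlr; rewrite /t nullT.
split=> [k Kk|]; last exact: bottom_up_NoSp.
have [x xin xk] := bottom_up_detects hG tauS cpD (hKstar _ Kk) (hbarG k Kk)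
  (starT k Kk) (hrbar k Kk) (htaubar k Kk).
exists (index x that); split; first by rewrite index_mem.
  by rewrite nth_index.
by have := hrbar k Kk; lra.
Qed.
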